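(* For positive integers $N,S$, let $e_n(s)$ ($1\le n\le N$, $1\le s\le S$) be drawn independently and uniformly at random from $\{-1,1\}$ and write $G_{N,S}(s)=(e_1(s),\dots,e_N(s))$. For every $\varepsilon>0$, \[ \mathbb{P}\Bigg[\Phi_k(G_{N,S})\le(1+\varepsilon)\sqrt{2N\log\left(\binom{SN}{k}-\binom{S(N-1)}{k}\right)}\ \text{ for all } k \text{ with } 2\le k<SN\Bigg]\to 1 \] as $N\to\infty$.
   Context: For a map $G_{N,S}:\{1,\dots,S\}\to\{-1,+1\}^N$, $G_{N,S}(s)=(e_1(s),\dots,e_N(s))$, the cross-correlation measure of order $k$ is \[ \Phi_k(G_{N,S})=\max\left|\sum_{n=1}^M e_{n+d_1}(s_1)\cdots e_{n+d_k}(s_k)\right|, \] the maximum taken over all integers $M,d_1,\dots,d_k$ and $1\le s_1,\dots,s_k\le S$ with $0\le d_1\le\dots\le d_k<M+d_k\le N$ and $d_i\ne d_j$ whenever $s_i=s_j$. $\log$ is the natural logarithm. *)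

(* Defs.v *)
From HB Require Import structures.
From mathcomp Require Import all_boot all_order all_algebra.
From mathcomp Require Import all_classical all_reals all_analysis.
Set Implicit Arguments. Unset Strict Implicit. Unset Printing Implicit Defensive.
Import Order.TTheory GRing.Theory Num.Theory.
Local Open Scope ring_scope.

(* A family G_{N,S}: S binary sequences of length N.  Indices are 0-based:
   e (s, n) encodes e_{n+1}(s+1); true ~ +1, false ~ -1. *)
Definition family (S N : nat) := {ffun 'I_S * 'I_N -> bool}.

(* the +-1 value e_{m+1}(s+1) (0-based index m); 0 outside the range *)
Definition esign (S N : nat) (e : family S N) (s : 'I_S) (m : nat) : int :=
  match insub m with
  | Some j => if e (s, j) then 1 else -1
  | None => 0
  end.

(* parameters (M, (d_1..d_k), (s_1..s_k)), 0-based in the tuple index *)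
Definition params (S N k : nat) :=
  ('I_N.+1 * {ffun 'I_k -> 'I_N} * {ffun 'I_k -> 'I_S})%type.

Definition admissible (S N k : nat) (p : params S N k) : bool :=
  let: (M, d, s) := p in
  [&& [forall i : 'I_k, forall j : 'I_k, (i <= j)%N ==> (d i <= d j)%N],
      (0 < M)%N,
      (M + \max_(i < k) (d i : nat) <= N)%N &
      [forall i : 'I_k, forall j : 'I_k, (i != j) && (s i == s j) ==> (d i != d j)]].

Definition corr_sum (S N k : nat) (e : family S N) (p : params S N k) : int :=
  let: (M, d, s) := p in
  \sum_(n < M) \prod_(i < k) esign e (s i) (n + d i)%N.

Definition Phi (S N k : nat) (e : family S N) : nat :=
  \max_(p : params S N k | admissible p) `|corr_sum e p|%N.

Definition good_event (R : realType) (S N : nat) (eps : R) : {set family S N} :=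
  [set e : family S N | [forall k : 'I_(S * N), (2 <= k)%N ==>
     ((Phi k e)%:R <= (1 + eps) * Num.sqrt (2 * N%:R *
        ln ('C(S * N, k)%:R - 'C(S * N.-1, k)%:R)))]].

Definition unif_prob (R : realType) (S N : nat) (A : {set family S N}) : R :=
  #|A|%:R / #|{: family S N}|%:R.
Arguments unif_prob R {S N} A.

(* Main.v *)
Require Import Defs.
From HB Require Import structures.
From mathcomp Require Import all_boot all_order all_algebra.
From mathcomp Require Import all_classical all_reals all_analysis.
From mathcomp Require Import ring lra zify.
Set Implicit Arguments. Unset Strict Implicit. Unset Printing Implicit Defensive.
Import Order.TTheory GRing.Theory Num.Theory.
Import numFieldNormedType.Exports.
Local Open Scope ring_scope.

(** Shifting all [d_i] by [d_1] turns a correlation sum of order [k] into a sum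
    over a window of consecutive terms of a process attached to a [k]-subset of
    [S] x [N] meeting the first column; there are
    [L = 'C(SN, k) - 'C(S(N-1), k)] such subsets.  Each process is a simple
    random walk: flipping the rightmost entry involved in the [n]-th term
    negates that term and preserves the earlier ones.  A union bound over the
    windows would lose a power of [N], which is too much for small [k].
    Instead, the largest window sum ending at time [n] is a walk reflected at
    [0], and [cosh (t X_n)] grows in mean by a factor at most [cosh t] per step,
    even when the walk is stopped on exceeding [lam]; hence all windows at once
    stay below [lam] in absolute value except with probability
    [4 exp (- lam^2 / (2N))].  With [lam = (1 + eps) sqrt (2 N ln L)] the union
    bound over the [L] subsets gives at most [4 L^(-2 eps)], and
    [L >= 'C(SN-1, k-1)] makes the sum over [k] tend to [0] uniformly in [S]. *)

(** * Sub-Gaussian bound for the hyperbolic cosine *)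

Lemma le_at0_of_derive_ge0 (R : realType) (f f' : R -> R) (t : R) :
  0 <= t -> (forall x : R, is_derive x 1 f (f' x)) ->
  (forall x, 0 <= x -> 0 <= f' x) -> f 0 <= f t.
Proof.
move=> t0 df f'0.
have f0 x : derivable f x 1 by have := df x; case.
apply: (@ger0_derive1_le_cc R f 0 t) => //.
- move=> x; rewrite in_itv/= => /andP[x0 _].
  by rewrite derive1E (@derive_val _ _ _ _ _ _ _ (df x)) f'0// ltW.
- by apply: derivable_within_continuous => x _.
- by rewrite in_itv/= lexx.
- by rewrite in_itv/= lexx t0.
Qed.

(** On [x >= 0] the function [cosh x * exp (- x^2 / 2)] is nonincreasing: its derivative has the
    sign of [sinh x - x cosh x], which is nonpositive by the same monotonicity argument. *)
Lemma cosh_le_expR_sqr (R : realType) (t : R) :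
  0 <= t -> expR t + expR (- t) <= 2 * expR (t ^+ 2 / 2).
Proof.
move=> t0.
pose f1 (x : R) := x * (expR x + expR (- x)) - (expR x - expR (- x)).
have f1_ge0 x : 0 <= x -> 0 <= f1 x.
  move=> x0; rewrite (_ : 0 = f1 0); last by rewrite /f1 oppr0; ring.
  apply: (@le_at0_of_derive_ge0 _ _ (fun y => y * (expR y - expR (- y)))) => //.
    move=> y; rewrite /f1; apply: is_derive_eq.
    rewrite /GRing.scale/=; ring.
  move=> y y0; rewrite mulr_ge0// subr_ge0 ler_expR; lra.
pose f2 (x : R) := - ((expR x + expR (- x)) * expR (- (x ^+ 2 / 2))).
have : f2 0 <= f2 t.
  apply: (@le_at0_of_derive_ge0 _ _ (fun y => f1 y * expR (- (y ^+ 2 / 2)))) => //.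
    move=> y; rewrite /f2; apply: is_derive_eq.
    by rewrite /f1 /GRing.scale/=; field.
  by move=> y y0; rewrite mulr_ge0 ?f1_ge0 ?expR_ge0.
rewrite /f2 lerN2 oppr0 expR0 expr0n/= mul0r oppr0 expR0 mulr1.
by rewrite [expR (- (_ / _))]expRN ler_pdivrMr ?expR_gt0.
Qed.

(** * Walks reflected at 0 *)

(* Truncated predecessor does the reflection at 0; the walk is frozen once it
   exceeds [lam]. *)
Fixpoint rwalk (R : realType) (lam : R) (u : nat -> int) (n : nat) : nat :=
  if n is m.+1 then
    let X := rwalk lam u m in
    if lam < X%:R then X else if u m == 1 then X.+1 else X.-1
  else 0%N.

Lemma eq_rwalk (R : realType) (lam : R) (u v : nat -> int) (n : nat) :
  (forall m, (m < n)%N -> u m = v m) -> rwalk lam u n = rwalk lam v n.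
Proof.
elim: n => //= n IHn uv; rewrite uv// IHn// => m mn.
by rewrite uv// (ltn_trans mn).
Qed.

Lemma rwalk_stopped (R : realType) (lam : R) (u : nat -> int) (m n : nat) :
  (m <= n)%N -> lam < (rwalk lam u m)%:R -> lam < (rwalk lam u n)%:R.
Proof.
move=> /subnK <-; elim: (n - m)%N => //= k IHk um.
by rewrite !IHk.
Qed.

(** Until it stops, the reflected walk dominates every window sum ending at the current time;
    reflection at 0 accounts for the empty window. *)
Lemma rwalk_hit (R : realType) (lam : R) (u : nat -> int) (T a b : nat) :
  (forall i, (i < T)%N -> `|u i| = 1) -> (a <= b)%N -> (b <= T)%N ->
  lam < (\sum_(a <= i < b) u i)%:~R -> lam < (rwalk lam u T)%:R.
Proof.
move=> u1 ab bT; suff [hit _ //|le_ab] : lam < (rwalk lam u b)%:R \/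
    forall a, (a <= b)%N -> \sum_(a <= i < b) u i <= (rwalk lam u b)%:Z.
- exact: (rwalk_stopped bT).
- move=> h; apply: (rwalk_stopped bT); apply: (lt_le_trans h).
  by rewrite [leRHS]pmulrn ler_int le_ab.
elim: b bT {ab} => [|b IHb] bT.
  by right=> c; rewrite leqn0 => /eqP ->; rewrite big_geq.
have [/(rwalk_stopped (leqnSn b))|le_b] := IHb (ltnW bT); first by left.
have [hit|nhit] := boolP (lam < (rwalk lam u b)%:R).
  by left; apply: (rwalk_stopped (leqnSn b)).
right=> c; rewrite leq_eqVlt => /predU1P[->|cb]; first by rewrite big_geq.
rewrite big_nat_recr//= (negbTE nhit); have := le_b _ cb; have := u1 _ bT.
move: (u b) (\sum_(_ <= _ < _) _) (rwalk _ _ _) => v s r; case: eqP => [->|]; lia.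
Qed.

(** For [X > 0] this is the identity [cosh (a + b) + cosh (a - b) = 2 cosh a cosh b]; at [X = 0] it
    reduces to [1 <= cosh t]. With [expR (t * X)] alone the bound would fail at 0 for [t > 0]. *)
Lemma cosh_reflected_step (R : realType) (t : R) (X : nat) : 0 <= t ->
  (expR (t * X.+1%:R) + expR (- (t * X.+1%:R))) +
  (expR (t * X.-1%:R) + expR (- (t * X.-1%:R))) <=
  (expR t + expR (- t)) * (expR (t * X%:R) + expR (- (t * X%:R))).
Proof.
move=> t0; have two_le : 2 <= expR t + expR (- t).
  by have := expR_ge1Dx t; have := expR_ge1Dx (- t); lra.
case: X => [|X]; first by rewrite mulr1 mulr0 oppr0 expR0; lra.
rewrite [X.+1.-1]/= -!natr1 le_eqVlt; apply/orP; left; apply/eqP.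
have -> : t * (X%:R + 1 + 1) = t + t * (X%:R + 1) by ring.
have -> : t * X%:R = - t + t * (X%:R + 1) by ring.
by rewrite !opprD opprK !expRD; ring.
Qed.

Section ReflectedWalk.
Variables (R : realType) (Omega : finType) (lam : R) (T : nat).
Variable x : nat -> Omega -> int.
Hypothesis x1 : forall n w, (n < T)%N -> `|x n w| = 1.
Hypothesis flip : forall n, (n < T)%N -> exists phi : Omega -> Omega,
  [/\ involutive phi, forall w, x n (phi w) = - x n w &
      forall m w, (m < n)%N -> x m (phi w) = x m w].

Let X n w := rwalk lam (x^~ w) n.

(** Induction on [n]: pairing [w] with [phi w], which has the same past and the opposite [n]-th
    step, replaces conditional expectation. *)
Lemma sum_cosh_rwalk (t : R) (n : nat) : 0 <= t -> (n <= T)%N ->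
  \sum_w (expR (t * (X n w)%:R) + expR (- (t * (X n w)%:R))) <=
  #|Omega|%:R * 2 * expR (t ^+ 2 / 2) ^+ n.
Proof.
move=> t0; elim: n => [|n IHn] nT.
  under eq_bigr do rewrite /X/= mulr0 oppr0 expR0.
  by rewrite expr0 mulr1 sumr_const mulr_natl.
have [phi [phiK phiN phiE]] := flip nT.
pose F k w := expR (t * (X k w)%:R) + expR (- (t * (X k w)%:R)).
have c1 : 1 <= expR (t ^+ 2 / 2) by rewrite -expR0 ler_expR divr_ge0// sqr_ge0.
have step w : F n.+1 w + F n.+1 (phi w) <= 2 * (expR (t ^+ 2 / 2) * F n w).
  have Xphi : X n (phi w) = X n w by apply: eq_rwalk => m mn; apply: phiE.
  have F0 : 0 <= F n w by rewrite addr_ge0 ?expR_ge0.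
  rewrite {1 2}/F /= /X/= -!/(X _ _) Xphi phiN; case: ifP => _.
    (* The walk is frozen: both summands equal [F n w], and [c1] suffices. *)
    by rewrite -/(F n w); nra.
  have : (x n w == 1) || (x n w == -1) by have := x1 w nT; lia.
  case/orP => /eqP->.
  - rewrite eqxx (_ : (-1 : int) == 1 = false)//.
    rewrite mulrA; apply: le_trans (cosh_reflected_step _ t0) _.
    by rewrite ler_wpM2r// cosh_le_expR_sqr.
  - rewrite opprK eqxx (_ : (-1 : int) == 1 = false)// addrC.
    rewrite mulrA; apply: le_trans (cosh_reflected_step _ t0) _.
    by rewrite ler_wpM2r// cosh_le_expR_sqr.
have : \sum_w (F n.+1 w + F n.+1 (phi w)) <=
    \sum_w 2 * (expR (t ^+ 2 / 2) * F n w) by apply: ler_sum.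
have sumphi : \sum_w F n.+1 (phi w) = \sum_w F n.+1 w.
  by rewrite [RHS](reindex_inj (inv_inj phiK)).
rewrite big_split/= sumphi.
rewrite -!mulr_sumr -mulr2n -[_ *+ 2]mulr_natl ler_pM2l// => /le_trans; apply.
rewrite [_ ^+ n.+1]exprS mulrCA ler_wpM2l ?expR_ge0//; exact: (IHn (ltnW nT)).
Qed.

(** Markov's inequality, keeping only the larger exponential of the hyperbolic cosine. *)
Lemma card_rwalk_hit (t : R) : 0 <= t ->
  #|[pred w | lam < (X T w)%:R]|%:R * expR (t * lam) <=
  #|Omega|%:R * 2 * expR (t ^+ 2 / 2) ^+ T.
Proof.
move=> t0; apply: le_trans (sum_cosh_rwalk t0 (leqnn T)).
rewrite mulr_natl -sumr_const.
apply: (@le_trans _ _ (\sum_(w in [pred w | lam < (X T w)%:R])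
    (expR (t * (X T w)%:R) + expR (- (t * (X T w)%:R))))).
  apply: ler_sum => w; rewrite inE => hit.
  rewrite -[leLHS]addr0 lerD ?expR_ge0// ler_expR ler_wpM2l// ltW//.
rewrite [leRHS](bigID [pred w | lam < (X T w)%:R])/= lerDl.
by apply: sumr_ge0 => w _; rewrite addr_ge0 ?expR_ge0.
Qed.

End ReflectedWalk.

(** Both [x] and [- x] are reflected, to catch either sign of a window sum. The constant 4 is 2
    signs times the initial value [exp 0 + exp 0]. *)
Lemma card_large_window (R : realType) (Omega : finType) (lam : R) (T N : nat)
    (x : nat -> Omega -> int) (B : {set Omega}) :
  0 <= lam -> (0 < N)%N -> (T <= N)%N ->
  (forall n w, (n < T)%N -> `|x n w| = 1) ->
  (forall n, (n < T)%N -> exists phi : Omega -> Omega,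
    [/\ involutive phi, forall w, x n (phi w) = - x n w &
        forall m w, (m < n)%N -> x m (phi w) = x m w]) ->
  (forall w, w \in B -> exists a b, [/\ (a <= b)%N, (b <= T)%N &
     lam < `|(\sum_(a <= i < b) x i w)%R|%N%:R]) ->
  #|B|%:R <= #|Omega|%:R * (4 * expR (- (lam ^+ 2 / (2 * N%:R)))).
Proof.
move=> lam0 N0 TN x1 flip hB.
pose y n w := - x n w.
have y1 n w : (n < T)%N -> `|y n w| = 1 by move=> nT; rewrite normrN x1.
have flipy n : (n < T)%N -> exists phi : Omega -> Omega,
    [/\ involutive phi, forall w, y n (phi w) = - y n w &
        forall m w, (m < n)%N -> y m (phi w) = y m w].
  move=> /flip[phi [phiK phiN phiE]]; exists phi; split=> // [w|m w mn].
    by rewrite /y phiN.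
  by rewrite /y phiE.
pose hit z := [pred w : Omega | lam < (rwalk lam (z^~ w) T)%:R].
have sBU : (#|B| <= #|hit x| + #|hit y|)%N.
  rewrite -cardUI; apply: leq_trans (leq_addr _ _).
  apply/subset_leq_card/fintype.subsetP => w /hB[a [b [ab bT h]]]; rewrite !inE.
  have [s0|s0] := leP 0 (\sum_(a <= i < b) x i w).
    apply/orP; left; apply: (rwalk_hit _ ab bT) => [i iT|]; first exact: x1.
    by move: h; rewrite pmulrn gez0_abs.
  apply/orP; right; apply: (rwalk_hit _ ab bT) => [i iT|]; first exact: y1.
  by move: h; rewrite pmulrn ltz0_abs// sumrN.
(* This [t] minimises [N t^2 / 2 - t lam], with minimum [- lam^2 / (2N)]. *)
pose t := lam / N%:R.
have N0' : (0 : R) < N%:R by rewrite ltr0n.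
have t0 : 0 <= t by rewrite divr_ge0// ltW.
have := card_rwalk_hit lam x1 flip t0; have := card_rwalk_hit lam y1 flipy t0.
rewrite -/(hit x) -/(hit y) => hy hx.
have {hx hy} h : #|B|%:R * expR (t * lam) <=
    #|Omega|%:R * 4 * expR (t ^+ 2 / 2) ^+ T.
  apply: (@le_trans _ _ ((#|hit x| + #|hit y|)%:R * expR (t * lam))).
    by rewrite ler_wpM2r ?expR_ge0// ler_nat.
  by rewrite natrD mulrDl; apply: le_trans (lerD hx hy) _; lra.
rewrite -(ler_pM2r (expR_gt0 (t * lam))); apply: (le_trans h).
rewrite -[leRHS]mulrA -[_ * 4 * _]mulrA ler_wpM2l// -[leRHS]mulrA ler_wpM2l//.
rewrite -expRD -expRM_natl ler_expR.
apply: (@le_trans _ _ (N%:R * (t ^+ 2 / 2))).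
  by rewrite ler_wpM2r ?ler_nat// divr_ge0// sqr_ge0.
rewrite le_eqVlt; apply/orP; left; apply/eqP; rewrite /t; field.
exact: lt0r_neq0.
Qed.

(** * Correlation sums as windows of processes attached to sets of entries *)

Section Shape.
Variables S N : nat.
Implicit Types (e : Defs.family S N) (A : {set 'I_S * 'I_N}).

(** [A] stands for the pairs [(s_i, d_i - d_1)]. Their order does not affect the product, so sets
    suffice, which keeps the union bound small. *)
Definition shape_term A (n : nat) e : int :=
  \prod_(q in A) esign e q.1 (n + q.2)%N.

Definition flip_entry (q : 'I_S * 'I_N) e : Defs.family S N :=
  [ffun r => if r == q then ~~ e r else e r].

Lemma flip_entryK q : involutive (flip_entry q).
Proof.
move=> e; apply/ffunP => r; rewrite !ffunE.
by case: eqP => // _; rewrite negbK.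
Qed.

Lemma esignE e s (m : 'I_N) : esign e s m = if e (s, m) then 1 else -1.
Proof. by rewrite /esign valK. Qed.

Lemma esign_flip_neq (q : 'I_S * 'I_N) e s m : (s, m) <> (q.1, q.2 : nat) ->
  esign (flip_entry q e) s m = esign e s m.
Proof.
move=> neq; rewrite /esign; case: insubP => //= j _ jm.
rewrite ffunE; case: eqP => // sjq; case: neq.
by rewrite -jm -sjq.
Qed.

Lemma norm_shape_term A n e :
  (forall q, q \in A -> (n + q.2 < N)%N) -> `|shape_term A n e| = 1.
Proof.
move=> hA; rewrite /shape_term normr_prod big1// => q /hA nq.
by rewrite (esignE e q.1 (Ordinal nq)); case: ifP.
Qed.

(* Only the factor at the column [n + q.2] furthest to the right is affected:
   all factors of the earlier terms lie strictly to the left of it. *)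
Lemma shape_term_flip A q n : q \in A ->
  (forall r, r \in A -> (r.2 <= q.2)%N) -> (n + q.2 < N)%N ->
  exists phi : Defs.family S N -> Defs.family S N,
  [/\ involutive phi, forall e, shape_term A n (phi e) = - shape_term A n e &
      forall m e, (m < n)%N -> shape_term A m (phi e) = shape_term A m e].
Proof.
move=> qA qmax nq; exists (flip_entry (q.1, Ordinal nq)).
split=> [|e|m e mn]; first exact: flip_entryK.
- rewrite /shape_term (bigD1 q)//= [in RHS](bigD1 q)//= -mulNr; congr (_ * _).
    rewrite !(esignE _ q.1 (Ordinal nq)) ffunE eqxx.
    by case: (e _); rewrite ?opprK.
  apply: eq_bigr => r /andP[_ rq]; apply: esign_flip_neq => /= -[r1 /addnI r2].
  move/eqP: rq; apply; rewrite [r]surjective_pairing [q]surjective_pairing r1.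
  by congr pair; apply: val_inj.
- apply: eq_bigr => r rA; apply: esign_flip_neq => /= -[_] mr.
  by have := leq_add mn (qmax _ rA); rewrite addSn mr ltnn.
Qed.

(** The condition on [b] keeps all columns below [N], where [esign] is a sign and not its default
    0. *)
Definition exceeds (R : realType) (lam : R) A : {set Defs.family S N} :=
  [set e : Defs.family S N | [exists a : 'I_N.+1, exists b : 'I_N.+1,
    [&& (a <= b)%N, [forall q in A, (b + q.2 <= N)%N] &
        lam < `|(\sum_(a <= i < b) shape_term A i e)%R|%N%:R]]].

Lemma card_exceeds (R : realType) (lam : R) A : 0 <= lam -> A != finset.set0 ->
  #|exceeds lam A|%:R <=
    #|{: Defs.family S N}|%:R * (4 * expR (- (lam ^+ 2 / (2 * N%:R)))).
Proof.
move=> lam0 /set0Pn[q0 q0A].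
(* A rightmost entry of [A] determines the number [N - q.2] of available terms and supplies the
   entries to flip. *)
have [q qA qmax] := arg_maxnP (fun q : 'I_S * 'I_N => nat_of_ord q.2) q0A.
have qN := ltn_ord q.2.
apply: (@card_large_window _ _ _ (N - q.2)%N _ (shape_term A)) => //.
- exact: leq_ltn_trans qN.
- exact: leq_subr.
- move=> n e; rewrite ltn_subRL addnC => nq; apply: norm_shape_term => r /qmax rq.
  by apply: leq_ltn_trans nq; rewrite leq_add2l.
- by move=> n; rewrite ltn_subRL addnC => nq; apply: (shape_term_flip qA).
- move=> e; rewrite inE => /existsP[a /existsP[b /and3P[ab /forall_inP bA h]]].
  by exists a, b; split => //; rewrite leq_subRL ?(ltnW qN)// addnC bA.
Qed.

Definition shapes (k : nat) : {set {set 'I_S * 'I_N}} :=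
  [set A : {set 'I_S * 'I_N} | (#|A| == k) &&
    ~~ (A \subset [set q : 'I_S * 'I_N | (0 < q.2)%N])].

Lemma card_shapes k : #|shapes k| = ('C(S * N, k) - 'C(S * N.-1, k))%N.
Proof.
set D := [set q : 'I_S * 'I_N | (0 < q.2)%N].
have cD : #|D| = (S * N.-1)%N.
  have -> : D = finset.setX finset.setT [set n : 'I_N | (0 < n)%N].
    by apply/setP => q; rewrite !inE.
  rewrite cardsX cardsT card_ord; congr (_ * _)%N.
  case: (N) => [|M]; first by apply/eqP; rewrite -leqn0 -[leqRHS](card_ord 0) max_card.
  rewrite -[in RHS](card_ord M.+1) -(cardsC1 (ord0 : 'I_M.+1)).
  by apply: eq_card => n; rewrite !inE lt0n.
have -> : shapes k = [set A : {set 'I_S * 'I_N} | #|A| == k] :\: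
    [set A : {set 'I_S * 'I_N} | A \subset D & #|A| == k].
  apply/setP => A; rewrite !inE; by case: (#|A| == k); case: (A \subset D).
rewrite cardsD (finset.setIidPr _); last first.
  by apply/fintype.subsetP => A; rewrite !inE => /andP[_ ->].
by rewrite card_draws cards_draws cD card_prod !card_ord.
Qed.

Lemma shapes_neq0 k A : A \in shapes k -> A != finset.set0.
Proof. by rewrite inE => /andP[_]; apply: contra => /eqP->; exact: finset.sub0set. Qed.

(** Admissibility makes the pairs [(s_i, d_i - d_1)] distinct, so they form a [k]-set, which meets
    the first column at the first pair. The window starts at [d_1] and has length [M]. *)
Lemma Phi_exceeds (R : realType) (lam : R) k e :
  0 <= lam -> (0 < k)%N -> lam < (Phi k e)%:R ->
  exists2 A, A \in shapes k & e \in exceeds lam A.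
Proof.
case: k => // k lam0 _ hPhi.
have [[[M d] s] adm hp] : exists2 p : params S N k.+1, admissible p &
    lam < `|corr_sum e p|%N%:R.
  (* An empty maximum is 0 and cannot exceed [lam >= 0]. *)
  move: hPhi; rewrite /Phi; elim/big_ind: _ => [|m n IHm IHn|p adm h].
  - by rewrite ltNge lam0.
  - by rewrite /maxn; case: ifP.
  - by exists p.
move: adm => /and4P[/forallP d_sorted M0 MN /forallP d_inj].
pose a := d ord0.
have ad i : (a <= d i)%N by have /forallP/(_ i)/implyP := d_sorted ord0; apply.
have dM i : (d i + M <= N)%N.
  by apply: leq_trans MN; rewrite addnC leq_add2l (leq_bigmax i).
have fN i : (d i - a < N)%N by apply: leq_ltn_trans (ltn_ord (d i)); exact: leq_subr.
pose f i : 'I_S * 'I_N := (s i, Ordinal (fN i)).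
have f_inj : injective f.
  move=> i j [sij dij]; apply/eqP; apply/negPn/negP => nij.
  have /forallP/(_ j)/implyP := d_inj i; rewrite nij sij eqxx => /(_ isT)/negP; apply.
  by apply/eqP/val_inj; rewrite /= -(subnK (ad i)) dij subnK.
exists [set f i | i in 'I_k.+1]%SET.
  rewrite inE card_imset// card_ord eqxx/=; apply/negP => /fintype.subsetP/(_ (f ord0)).
  by rewrite imset_f// inE/= subnn => /(_ isT).
have aMN : (a + M < N.+1)%N by exact: dM.
have aN : (a < N.+1)%N by rewrite ltnS (@leq_trans (a + M))// leq_addr.
rewrite inE; apply/existsP; exists (Ordinal aN); apply/existsP; exists (Ordinal aMN).
apply/and3P; split; first exact: leq_addr.
  apply/forall_inP => _ /imsetP[i _ ->]/=.
  by rewrite addnAC subnKC.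
move: hp; congr (_ < `|_|%N%:R) => /=.
rewrite -[X in index_iota X _](add0n a) big_addn addKn big_mkord.
apply: eq_bigr => n _; rewrite /shape_term big_imset/=; last first.
  by move=> i j _ _; exact: f_inj.
by apply: eq_bigr => i _; rewrite -addnA subnKC.
Qed.

End Shape.

(** * Lower bounds for binomial coefficients and the sum over the orders *)

Lemma leq_bin_self (m j : nat) : (0 < j < m)%N -> (m <= 'C(m, j))%N.
Proof.
elim: m j => [|m IHm] [|j]//=; rewrite ltnS leq_eqVlt => /predU1P[<-|jm].
  by rewrite binSn.
rewrite binS; case: j jm => [|j] jm; first by rewrite bin0 bin1 addn1.
by rewrite -addn1 leq_add ?bin_gt0 ?IHm// ltnW// ltnW.
Qed.

(** Raising both indices by one multiplies the coefficient by [(m + 1) / (i + 1)], here at least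
    2. *)
Lemma leq_exp2_bin (m i : nat) : (i.*2 <= m)%N -> (2 ^ i <= 'C(m, i))%N.
Proof.
elim: i m => [m _|i IHi [|m]//]; first by rewrite bin0.
rewrite doubleS ltnS => im.
rewrite -(leq_pmul2l (ltn0Sn i)) -mul_bin_diag expnS mulnCA mulnA.
by rewrite leq_mul ?IHi ?mul2n ?doubleS// ltnW.
Qed.

(** One factor of the square is bounded by [m], which will give decay in [N]; the other by a power
    of 2, which makes the sum over [k] bounded. *)
Lemma leq_bin_sqr (m j : nat) : (0 < j < m)%N ->
  (m * 2 ^ minn j (m - j) <= 'C(m, j) ^ 2)%N.
Proof.
move=> jm; rewrite expnS expn1 leq_mul ?leq_bin_self//.
have [le|lt] := leqP j (m - j).
  by apply: leq_exp2_bin; lia.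
by rewrite -bin_sub; [apply: leq_exp2_bin; lia | lia].
Qed.

Section TailSum.
Variables (R : realType) (eps : R).
Hypothesis eps0 : 0 < eps.
Let q : R := expR (- (eps * ln 2)).

Let q_lt1 : q < 1.
Proof. by rewrite /q expR_lt1 oppr_lt0 mulr_gt0// ln_gt0// ltr1n. Qed.

Let q_ge0 : 0 <= q. Proof. exact: expR_ge0. Qed.

(** The previous bound raised to the power [- eps], with [q = 2^(- eps)]; the power with the minimum
    as exponent is at most the sum of both powers. *)
Lemma expR_ln_bin (m j : nat) : (0 < j < m)%N ->
  expR (- (2 * eps * ln 'C(m, j)%:R)) <=
  expR (- (eps * ln m%:R)) * (q ^+ j + q ^+ (m - j)).
Proof.
move=> jm; set C := 'C(m, j).
have C0 : (0 : R) < C%:R by rewrite ltr0n bin_gt0; lia.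
have m0 : (0 : R) < m%:R by rewrite ltr0n; lia.
have lnC : ln m%:R + ln 2 *+ minn j (m - j) <= ln (C%:R : R) * 2.
  rewrite -lnXn// -lnM ?posrE ?exprn_gt0// mulr_natr -lnXn// ler_ln ?posrE ?exprn_gt0//.
    by rewrite -!natrX -natrM ler_nat leq_bin_sqr.
  by rewrite mulr_gt0 ?exprn_gt0.
apply: (@le_trans _ _ (expR (- (eps * ln m%:R)) * q ^+ minn j (m - j))).
  rewrite /q -expRM_natl -expRD ler_expR -mulr_natl in lnC *.
  have := ler_wpM2l (ltW eps0) lnC; lra.
rewrite ler_wpM2l ?expR_ge0//.
by case: leqP => _; rewrite ?lerDl ?lerDr exprn_ge0.
Qed.

Lemma sum_geometric_le (n : nat) : \sum_(i < n) q ^+ i <= (1 - q)^-1.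
Proof.
rewrite -[leRHS]mul1r ler_pdivlMr ?subr_gt0// mulrC -opprB mulNr -subrX1.
by rewrite opprB gerBl exprn_ge0.
Qed.

Lemma sum_expR_ln_bin (n : nat) :
  \sum_(k < n | (2 <= k)%N) expR (- (2 * eps * ln 'C(n.-1, k.-1)%:R)) <=
  expR (- (eps * ln n.-1%:R)) * ((q^-1 + 1) * (1 - q)^-1).
Proof.
have q0 : 0 < q by exact: expR_gt0.
have B0 (k : 'I_n) : 0 <= expR (- (eps * ln n.-1%:R)) *
    (q^-1 * q ^+ k + q ^+ rev_ord k) :> R.
  by rewrite mulr_ge0 ?expR_ge0// addr_ge0 ?mulr_ge0 ?invr_ge0 ?exprn_ge0.
apply: (@le_trans _ _ (\sum_(k < n | (2 <= k)%N)
    expR (- (eps * ln n.-1%:R)) * (q^-1 * q ^+ k + q ^+ rev_ord k))).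
  apply: ler_sum => k k2; have kn := ltn_ord k.
  apply: (le_trans (expR_ln_bin _)); first lia.
  rewrite ler_wpM2l ?expR_ge0//.
  (* The shift in [k.-1] costs the factor [q^-1]; the other exponent [n - k] is lowered by one to
     match [rev_ord k]. *)
  have -> : q ^+ k.-1 = q^-1 * q ^+ k.
    by rewrite -[in RHS](prednK (ltnW k2)) exprS mulKf// gt_eqF.
  rewrite lerD2l ler_wiXn2l// ?ltW//=; lia.
apply: (@le_trans _ _ (\sum_(k < n)
    expR (- (eps * ln n.-1%:R)) * (q^-1 * q ^+ k + q ^+ rev_ord k))).
  by rewrite [leRHS](bigID (fun k : 'I_n => (2 <= k)%N))/= lerDl sumr_ge0.
rewrite -mulr_sumr ler_wpM2l ?expR_ge0// big_split/= -mulr_sumr mulrDl mul1r.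
rewrite lerD ?ler_wpM2l ?invr_ge0 ?sum_geometric_le//.
have -> : \sum_(k < n) q ^+ rev_ord k = \sum_(k < n) q ^+ k.
  by rewrite [RHS](reindex_inj rev_ord_inj).
exact: sum_geometric_le.
Qed.

End TailSum.

Lemma card_bigcup_le (I T : finType) (P : pred I) (F : I -> {set T}) :
  (#|\bigcup_(i | P i) F i|%SET <= \sum_(i | P i) #|F i|)%N.
Proof.
elim/big_rec2: _ => [|i m A _ IH]; first by rewrite cards0.
by apply: leq_trans (leq_card_setU _ _) _; rewrite leq_add2l.
Qed.

(** * Union bound over shapes and orders *)

Section UnionBound.
Variables (R : realType) (S N : nat) (eps : R).
Hypotheses (S0 : (0 < S)%N) (N0 : (0 < N)%N) (eps0 : 0 < eps).

Let threshold (k : nat) : R := (1 + eps) * Num.sqrt (2 * N%:R *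
  ln ('C(S * N, k)%:R - 'C(S * N.-1, k)%:R)).

Lemma leq_bin_mul_pred k : ('C(S * N.-1, k) <= 'C(S * N, k))%N.
Proof. by rewrite leq_bin2l// leq_mul2l leq_pred orbT. Qed.

(** Pascal's rule together with [S (N - 1) <= S N - 1]. *)
Lemma leq_bin_shapes k : (0 < k)%N ->
  ('C((S * N).-1, k.-1) <= #|shapes S N k|)%N.
Proof.
case: k => // k _; rewrite card_shapes /= leq_subRL ?leq_bin_mul_pred//.
have SN : (0 < S * N)%N by rewrite muln_gt0 S0.
rewrite -[in leqRHS](prednK SN) binS leq_add2r leq_bin2l//.
rewrite -ltnS (prednK SN) ltn_mul2l S0/= prednK//.
Qed.

Lemma threshold_ge0 k : 0 <= threshold k.
Proof. by rewrite mulr_ge0 ?sqrtr_ge0// addr_ge0// ltW. Qed.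

Lemma sum_card_exceeds (k : nat) : (2 <= k < S * N)%N ->
  (\sum_(A in shapes S N k) #|exceeds (threshold k) A|)%:R <=
  #|{: Defs.family S N}|%:R *
    (4 * expR (- (2 * eps * ln 'C((S * N).-1, k.-1)%:R))).
Proof.
move=> /andP[k2 kSN].
have C0 : (0 < 'C((S * N).-1, k.-1))%N by rewrite bin_gt0; lia.
have CL := leq_bin_shapes (ltnW k2).
set L := #|shapes S N k| in CL.
have L0 : (0 < L)%N by exact: leq_trans CL.
have lnL : 0 <= ln L%:R :> R by rewrite ln_ge0// ler1n.
apply: (@le_trans _ _ (\sum_(A in shapes S N k) #|{: Defs.family S N}|%:R *
    (4 * expR (- (threshold k ^+ 2 / (2 * N%:R)))))).
  rewrite natr_sum; apply: ler_sum => A Ak.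
  by apply: card_exceeds (threshold_ge0 k) _; exact: shapes_neq0 Ak.
rewrite sumr_const -/L -[leLHS]mulr_natr -[leLHS]mulrA ler_wpM2l//.
rewrite -[leLHS]mulrA ler_wpM2l//.
have -> : threshold k ^+ 2 / (2 * N%:R) = (1 + eps) ^+ 2 * ln L%:R.
  rewrite /threshold -natrB ?leq_bin_mul_pred// -card_shapes -/L.
  rewrite exprMn sqr_sqrtr; last by rewrite mulr_ge0// mulr_ge0.
  by field; rewrite pnatr_eq0 -lt0n.
(* The number [L] of shapes joins the exponent; [(1 + eps)^2 - 1 >= 2 eps] then leaves at most
   [L^(-2 eps)]. *)
rewrite -[X in _ * X]lnK ?posrE ?ltr0n// -expRD ler_expR.
have : ln 'C((S * N).-1, k.-1)%:R <= ln L%:R :> R.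
  by rewrite ler_ln ?posrE ?ltr0n ?ler_nat.
move=> /(ler_wpM2l (ltW eps0)).
have : 0 <= eps ^+ 2 * ln L%:R by rewrite mulr_ge0// sqr_ge0.
nra.
Qed.

Lemma sub_bad_event :
  finset.setC (good_event S N eps) \subset
  (\bigcup_(k < S * N | (2 <= k)%N) \bigcup_(A in shapes S N k)
    exceeds (threshold k) A)%SET.
Proof.
apply/fintype.subsetP => e; rewrite !inE => /forallPn[k].
rewrite negb_imply -ltNge => /andP[k2 h].
have [|A Ak eA] := Phi_exceeds (threshold_ge0 k) _ h; first exact: ltnW.
by apply/bigcupP; exists k => //; apply/bigcupP; exists A.
Qed.

Lemma unif_prob_good_event :
  1 - 4 * \sum_(k < S * N | (2 <= k)%N)
    expR (- (2 * eps * ln 'C((S * N).-1, k.-1)%:R))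
  <= unif_prob R (good_event S N eps).
Proof.
have F0 : (0 : R) < #|{: Defs.family S N}|%:R.
  by rewrite ltr0n card_ffun card_bool expn_gt0.
rewrite /unif_prob ler_pdivlMr// mulrBl mul1r lerBlDr -lerBlDl.
rewrite -natrB ?max_card//.
have -> : (#|{: Defs.family S N}| - #|good_event S N eps| =
    #|finset.setC (good_event S N eps)|)%N.
  by rewrite -(cardsC (good_event S N eps)) addKn.
apply: (@le_trans _ _ (\sum_(k < S * N | (2 <= k)%N)
    \sum_(A in shapes S N k) #|exceeds (threshold k) A|)%:R).
  rewrite ler_nat; apply: leq_trans (subset_leq_card sub_bad_event) _.
  apply: leq_trans (card_bigcup_le _ _) _.
  by apply: leq_sum => k _; exact: card_bigcup_le.
rewrite natr_sum mulr_sumr [leRHS]mulrC mulr_sumr; apply: ler_sum => k k2.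
by apply: sum_card_exceeds; rewrite k2 ltn_ord.
Qed.

End UnionBound.

(** * Passage to the limit *)

Lemma unif_prob_le1 (R : realType) (S N : nat) (A : {set Defs.family S N}) :
  unif_prob R A <= 1.
Proof.
rewrite /unif_prob ler_pdivrMr ?mul1r ?ler_nat ?max_card//.
by rewrite ltr0n card_ffun card_bool expn_gt0.
Qed.

Local Open Scope classical_set_scope.

Lemma cvg_expR_ln_pred (R : realType) (eps : R) : 0 < eps ->
  expR (- (eps * ln n.-1%:R)) @[n --> \oo] --> (0 : R).
Proof.
move=> eps0; apply: (cvg_comp (fun n : nat => eps * ln n.-1%:R) _ _ (@cvgr_expR R)).
apply/cvgryPge => A.
have [M _ hM] : \forall n \near \oo, expR (A / eps) <= n%:R :> R.
  exact: nbhs_infty_ger.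
near=> n.
rewrite mulrC -ler_pdivrMr//.
have le_n : expR (A / eps) <= n.-1%:R.
  apply: hM => /=; have : (M < n)%N by near: n; exists M.+1.
  by case: (n).
by rewrite -[leLHS]expRK ler_ln ?posrE ?expR_gt0// (lt_le_trans _ le_n) ?expR_gt0.
Unshelve. all: by end_near. Qed.

(** Letting [S] be an arbitrary function of [N] expresses uniformity in the number of sequences. *)
Theorem theorem3 (R : realType) (S : nat -> nat) (hS : forall N, (0 < S N)%N)
  (eps : R) (heps : 0 < eps) :
  (fun N : nat => unif_prob R (good_event (S N) N eps)) @ \oo --> (1 : R).
Proof.
pose q : R := expR (- (eps * ln 2)).
pose K : R := 4 * ((q^-1 + 1) * (1 - q)^-1).
have K0 : 0 <= K.
  rewrite !mulr_ge0// ?addr_ge0 ?invr_ge0 ?expR_ge0// subr_ge0.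
  by rewrite expR_le1 oppr_le0 mulr_ge0 ?ln_ge0 ?ler1n// ltW.
apply: (@squeeze_cvgr _ _ _ _ (fun N : nat => 1 - K * expR (- (eps * ln N.-1%:R)))
  (fun=> 1)); last exact: cvg_cst.
- near=> N; rewrite unif_prob_le1 andbT.
  have N1 : (1 < N)%N by near: N; exists 2%N.
  have N0 := ltnW N1; have SN := hS N.
  apply: le_trans (unif_prob_good_event SN N0 heps).
  rewrite lerD2l lerN2; apply: (@le_trans _ _ (4 *
    (expR (- (eps * ln (S N * N).-1%:R)) * ((q^-1 + 1) * (1 - q)^-1)))).
    by rewrite ler_wpM2l// sum_expR_ln_bin.
  rewrite mulrCA -/K mulrC ler_wpM2l// ler_expR lerN2 ler_wpM2l ?(ltW heps)//.
  (* Monotonicity of [ln] removes [S] from the bound; [1 < N] keeps its arguments positive. *)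
  have NSN : (N <= S N * N)%N by rewrite leq_pmull.
  by rewrite ler_ln ?posrE ?ltr0n ?ler_nat; lia.
- rewrite -[X in _ --> X]subr0 -(mulr0 K).
  apply: cvgB; first exact: cvg_cst.
  by apply: cvgMr; exact: cvg_expR_ln_pred.
Unshelve. all: by end_near. Qed.
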